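(* Consider the normal means model $y=\beta^{(n)}+\varepsilon$, $\varepsilon\sim N(0,I_n)$. Let $\zeta\in(0,1]$ and let $t(n,s_n)$ be a positive function. If a monotone estimator $\widehat\beta(\cdot)$ belongs to $\Omega_1$, then $\widehat\beta(\cdot)\in\Omega_2$.
   Context: An estimator $\widehat\beta(\cdot)$ is a (measurable) map $\mathbb R^n\to\mathbb R^n$, $y\mapsto\widehat\beta(y)$, for each $n$. For $y,z\in\mathbb R^n$, $y$ majorizes $z$ if $\mathrm{sign}(y_i)\mathrm{sign}(z_i)\ge0$ and $|y_i|\ge|z_i|$ for all $i$ (with $\mathrm{sign}(0)=0$). The estimator is monotone if $\widehat\beta(y)$ majorizes $\widehat\beta(z)$ whenever $y$ majorizes $z$. For a vector $\beta$: $\xi(\beta)=\{j:\beta_j\ne0\}$; $\|\beta\|_{\min}=\min_{\beta_i\ne0}|\beta_i|$ (equal to $+\infty$ if $\beta=0$); $\mathcal B(n,s_n)=\{\beta\in\mathbb R^n:|\xi(\beta)|\le s_n\}$. $P_{\beta}$ is the law of $y\sim N(\beta,I_n)$. $\mathrm{FP}(\widehat\beta(y))=|\xi(\widehat\beta(y))\setminus\xi(\beta^{(n)})|$. $\Omega_1$ is the class of estimators such that $\lim_nP_{\beta^{(n)}}[\xi(\widehat\beta(y))=\xi(\beta^{(n)})]=1$ for any sequence $\beta^{(n)}\in\mathcal B(n,s_n)$ satisfying $\limsup s_n/n\le\zeta$ and $\|\beta^{(n)}\|_{\min}\ge t(n,s_n)$. $\Omega_2$ is the class of estimators such that $\lim_nP_{\beta^{(n)}}[\mathrm{FP}(\widehat\beta(y))=0]=1$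 for any sequence $\beta^{(n)}\in\mathcal B(n,s_n)$ with $\limsup s_n/n\le\zeta$. *)

(* Defs.v *)
From HB Require Import structures.
From mathcomp Require Import all_boot all_order all_algebra.
From mathcomp Require Import all_classical all_reals all_analysis.
From mathcomp Require Import measurable_realfun.

Set Implicit Arguments.
Unset Strict Implicit.
Unset Printing Implicit Defensive.

Import Order.TTheory GRing.Theory Num.Theory.
Import numFieldNormedType.Exports.

Local Open Scope classical_set_scope.
Local Open Scope ring_scope.

Section gaussian_law.
Context {R : realType}.

(* [measurableTypeR R] is R with the Borel sigma-algebra; vectors in R^n are
   tuples, which carry the product sigma-algebra. *)
Definition vec (n : nat) := n.-tuple (measurableTypeR R).

Definition vcons n (p : measurableTypeR R * vec n) : vec n.+1 :=
  [the n.+1.-tuple (measurableTypeR R) of p.1 :: p.2].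

Lemma measurable_vcons n : measurable_fun setT (@vcons n).
Proof. exact: measurable_cons. Qed.

HB.instance Definition _ n := isMeasurableFun.Build _ _ _ _
  (@vcons n) (@measurable_vcons n).

Definition vshift n (b e : vec n) : vec n :=
  [tuple (tnth b i + tnth e i : measurableTypeR R) | i < n].

Lemma measurable_vshift n (b : vec n) : measurable_fun setT (vshift b).
Proof.
apply/measurable_fun_tnthP => i.
rewrite (_ : _ \o _ = fun e : vec n => (tnth b i + tnth e i : R)); last first.
  by apply/funext => e /=; rewrite tnth_mktuple.
by apply: measurable_funD => //; exact: measurable_tnth.
Qed.

HB.instance Definition _ n (b : vec n) := isMeasurableFun.Build _ _ _ _
  (vshift b) (measurable_vshift b).

(* N(0, I_n), the n-fold product of N(0, 1) *)
Fixpoint std_gaussian (n : nat) : probability (vec n) R :=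
  match n with
  | 0%N => \d_ ([tuple] : vec 0)
  | n'.+1 => distribution
      (normal_prob 0 1 \x std_gaussian n')%E (@vcons n')
  end.

(* N(b, I_n), the law of y = b + e with e ~ N(0, I_n) *)
Definition gaussian n (b : vec n) : probability (vec n) R :=
  distribution (std_gaussian n) (vshift b).

(* The coordinates under N(0, I_n) are i.i.d. N(0, 1) *)
Lemma std_gaussian_box n (A : 'I_n -> set (measurableTypeR R)) :
  (forall i, measurable (A i)) ->
  std_gaussian n [set e | forall i, A i (tnth e i)] =
  (\prod_(i < n) normal_prob 0 1 (A i))%E.
Proof.
elim: n A => [|n IH] A mA.
  rewrite big_ord0 /= diracE mem_set //.
  by move=> [].
rewrite big_ord_recl -IH// /= /distribution /pushforward.
rewrite -product_measure1E//.
- congr (product_measure1 _ _ _); apply/seteqP; split => -[x e] /=.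
    by move=> H; split; [exact: (H ord0)|move=> i; have := H (lift ord0 i);
      rewrite /vcons tnthS].
  by move=> [H0 H] i; case: (unliftP ord0 i) => [j|] ->; rewrite ?tnthS.
- rewrite (_ : mkset _ =
     \big[setI/setT]_(i < n) ((@tnth n _)^~ i @^-1` A (lift ord0 i))).
    apply: bigsetI_measurable => i _; rewrite -[X in measurable X]setTI.
    exact: measurable_tnth.
  rewrite -bigcap_seq; apply/seteqP; split => e /=.
    by move=> H i _; exact: H.
  by move=> H i; apply: H; rewrite /= mem_index_enum.
Qed.

End gaussian_law.

Arguments vec : clear implicits.

Section normal_means.
Context {R : realType}.

Definition estimator := forall n : nat, {mfun vec R n >-> vec R n}.

Definition majorizes n (y z : vec R n) : Prop := forall i : 'I_n,
  0 <= Num.sg (tnth y i : R) * Num.sg (tnth z i : R) /\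
  `|tnth z i : R| <= `|tnth y i : R|.

Definition monotone_estimator (bhat : estimator) : Prop :=
  forall (n : nat) (y z : vec R n),
    majorizes y z -> majorizes (bhat n y) (bhat n z).

Definition xi n (b : vec R n) : {set 'I_n} :=
  [set j | (tnth b j : R) != 0]%SET.

Definition norm_min n (b : vec R n) : \bar R :=
  (\big[Order.min/+oo]_(i < n | i \in xi b) (`|tnth b i : R|%R)%:E)%E.

Definition sparse (n s : nat) : set (vec R n) := [set b | (#|xi b| <= s)%N].

Definition FP n (b bh : vec R n) : nat := #|xi bh :\: xi b|.

(* limsup s_n / n <= zeta; the limsup is taken in the extended reals, and the
   (irrelevant) term n = 0 is 0. *)
Definition asymp_sparsity (zeta : R) (s : nat -> nat) : Prop :=
  (limn_esup (fun n => ((s n)%:R / n%:R)%:E) <= zeta%:E)%E.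

Definition Omega1 (zeta : R) (t : nat -> nat -> R) (bhat : estimator) : Prop :=
  forall (s : nat -> nat) (beta : forall n, vec R n),
    (forall n, sparse (s n) (beta n)) ->
    asymp_sparsity zeta s ->
    (forall n, ((t n (s n))%:E <= norm_min (beta n))%E) ->
    gaussian (beta n) [set y | xi (bhat n y) = xi (beta n)]
      @[n --> \oo] --> 1%E.

Definition Omega2 (zeta : R) (bhat : estimator) : Prop :=
  forall (s : nat -> nat) (beta : forall n, vec R n),
    (forall n, sparse (s n) (beta n)) ->
    asymp_sparsity zeta s ->
    gaussian (beta n) [set y | FP (beta n) (bhat n y) = 0%N]
      @[n --> \oo] --> 1%E.

End normal_means.

Arguments estimator : clear implicits.

(* Main.v *)
Require Import Defs.
From mathcomp Require Import all_boot all_order all_algebra.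
From mathcomp Require Import all_classical all_reals all_analysis.
From mathcomp Require Import measurable_realfun lra.

Set Implicit Arguments.
Unset Strict Implicit.
Unset Printing Implicit Defensive.

Import Order.TTheory GRing.Theory Num.Theory.

Local Open Scope classical_set_scope.
Local Open Scope ring_scope.

(** Let A be the event of a false positive; monotonicity makes A upward closed
    for majorization.  Replacing the nonzero means of beta by very large means of
    suitably chosen signs increases P(A) up to an arbitrarily small error: one
    coordinate is treated at a time, and its sign is the one for which the average
    of the indicator of A over the other coordinates is larger.  The signs cannot be
    those of beta, since a small mean may produce observations of the opposite sign,
    and these are not majorized by the boosted ones.  The boosted means satisfy the
    minimal signal condition, so P(A) tends to 0 under them by exact support
    recovery, hence under beta as well. *)

(** * Moving the mean of a single coordinate *)

Section line.
Context {R : realType} (mu : probability (measurableTypeR R) R).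

Let measurable_tail (m : R) :
  measurable [set x : measurableTypeR R | m < `|x : R|].
Proof.
rewrite -[X in measurable X]setTI.
have mnorm : measurable_fun setT (fun x : measurableTypeR R => `|x : R|).
  exact: measurableT_comp.
rewrite (_ : [set x | _] = (fun x : R => `|x|) @^-1` `]m, +oo[%classic).
  by apply: mnorm => //; exact: measurable_itv.
by apply/seteqP; split => x /=; rewrite in_itv/= andbT.
Qed.

(** The tails [F k] decrease to the empty set, so their measures tend to 0 by continuity from
    above. *)
Lemma probability_tail (delta : R) : 0 < delta ->
  exists m : R, 0 <= m /\
    (mu [set x : measurableTypeR R | (m < `|x : R|)%R] <= delta%:E)%E.
Proof.
move=> d0.
pose F (k : nat) := [set x : measurableTypeR R | k%:R < `|x : R|].
have F0 : \bigcap_k F k = set0.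
  apply/seteqP; split => // x Fx.
  have := Fx (Num.truncn `|x : R|).+1 Logic.I.
  by rewrite /F /= ltNge ltW// truncnS_gt.
have mF k : measurable (F k) by exact: measurable_tail.
have cvgF : mu \o F @ \oo --> (0%E : \bar R).
  rewrite -(measure0 mu) -F0; apply: nonincreasing_cvg_mu => //.
  - by apply: le_lt_trans (probability_le1 _ _) _ => //; rewrite ltry.
  - by rewrite F0.
  - move=> k l kl; apply/subsetPset => x; rewrite /F /=.
    by apply: le_lt_trans; rewrite ler_nat.
have [|k _ kP] := cvgF [set y | (y < delta%:E)%E].
  by apply: (@open_ereal_lt_ereal R delta%:E); rewrite /= lte_fin.
exists k%:R; split => //.
by apply/ltW; apply: (kP k) => /=.
Qed.

(* Off the event |x| > m, both b + x and K + x are controlled by the point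
   |b| + m: the former has smaller modulus, the latter is further out.  Moving the
   mean to K or to - K according to which of |b| + m and - (|b| + m) has the
   larger image by H thus increases H pointwise. *)
Lemma shift_mean (H : measurableTypeR R -> \bar R) (b T delta : R) :
  measurable_fun setT H -> (forall x, 0 <= H x <= 1)%E ->
  (forall x y : R, 0 <= Num.sg x * Num.sg y -> `|y| <= `|x| -> (H y <= H x)%E) ->
  0 < delta ->
  exists b' : R, T <= `|b'| /\
    (\int[mu]_x H (b + x : R)%R <= \int[mu]_x H (b' + x : R)%R + delta%:E)%E.
Proof.
move=> mH H01 Hmono d0.
have [m [m0 tail]] := probability_tail d0.
(* [K >= M + m] keeps [K + x] beyond [M] whenever [|x| <= m]; [K >= T] gives the required size of
   the new mean. *)
pose M := `|b| + m; pose K := Num.max T (M + m).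
have M0 : 0 <= M by rewrite addr_ge0.
have KM : M + m <= K by rewrite le_max lexx orbT.
have K0 : 0 <= K by apply: le_trans KM; rewrite addr_ge0.
have TK : T <= K by rewrite le_max lexx.
have sgM (x y : R) : 0 <= x -> 0 <= y -> 0 <= Num.sg x * Num.sg y.
  by move=> ? ?; rewrite mulr_ge0// sgr_ge0.
have Hpos (x y : R) : 0 <= y -> y <= x -> (H y <= H x)%E.
  move=> y0 yx; have x0 := le_trans y0 yx.
  by apply: Hmono; rewrite ?sgM// !ger0_norm.
have Hneg (x y : R) : y <= 0 -> x <= y -> (H y <= H x)%E.
  move=> y0 xy; have x0 := le_trans xy y0.
  apply: Hmono; last by rewrite !ler0_norm// lerN2.
  by rewrite -mulrNN -!sgrN sgM// oppr_ge0.
(* A pointwise comparison for [|x| <= m] suffices: on the tail, [H <= 1] is absorbed by the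
   indicator of the tail, whose integral is at most [delta]. *)
suff [b' [Tb' Hb']] : exists b' : R, T <= `|b'| /\
    forall x : R, `|x| <= m -> (H (b + x : R)%R <= H (b' + x : R)%R)%E.
  exists b'; split => //.
  have mshift (c : R) : measurable_fun setT (fun x : measurableTypeR R => H (c + x : R)).
    by apply: (measurableT_comp mH); exact: measurable_funD.
  have mind : measurable_fun setT (fun x : measurableTypeR R =>
      (\1_[set x : measurableTypeR R | m < `|x : R|] x : R)%:E).
    by apply/measurable_EFinP; exact: measurable_indic.
  have tailE : (\int[mu]_x (\1_[set x : measurableTypeR R | (m < `|x : R|)%R] x : R)%:E <= delta%:E)%E.
    by rewrite integral_indic// setIT.
  apply: (@le_trans _ _ (\int[mu]_x (H (b' + x : R)%R +
      (\1_[set x : measurableTypeR R | (m < `|x : R|)%R] x : R)%:E))%E); last first.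
    rewrite ge0_integralD//; first by rewrite leeD2l.
    by move=> x _; have /andP[] := H01 (b' + x : R).
  apply: ge0_le_integral => //.
  - by move=> x _; have /andP[] := H01 (b + x : R).
  - exact: emeasurable_funD.
  - move=> x _; have /andP[H0 H1] := H01 (b' + x : R).
    have [xm|xm] := leP `|x : R| m.
      by apply: le_trans (Hb' _ xm) _; rewrite leeDl// lee_fin.
    rewrite indicE mem_set//; apply: (@le_trans _ _ 1%E); last by rewrite leeDr.
    by have /andP[] := H01 (b + x : R).
have bx (x : R) : `|x| <= m -> (H (b + x : R)%R <= Order.max (H M) (H (- M)%R))%E.
  move=> xm; rewrite le_max.
  have bxM : `|b + x| <= M by apply: le_trans (ler_normD _ _) _; rewrite lerD2l.
  move: bxM; rewrite ler_norml => /andP[bxM Mbx].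
  have [p|n] := leP 0 (b + x); first by rewrite Hpos.
  by rewrite orbC Hneg// ltW.
have [MM|MM] := leP (H (- M)%R) (H M).
  exists K; rewrite ger0_norm//; split => // x xm.
  apply: le_trans (bx _ xm) _; rewrite max_l//; apply: Hpos => //.
  by move: xm; rewrite ler_norml => /andP[]; lra.
exists (- K); rewrite normrN ger0_norm//; split => // x xm.
apply: le_trans (bx _ xm) _; rewrite max_r ?(ltW MM)//.
apply: Hneg; first by rewrite oppr_le0.
by move: xm; rewrite ler_norml => /andP[]; lra.
Qed.

End line.

(** * Supports: measurability and majorization *)

Section support.
Context {R : realType} (n : nat).

(** There are finitely many supports, and having a given one is a finite intersection of conditions
    on single coordinates. *)
Lemma measurable_xi (Q : {set 'I_n} -> Prop) :
  measurable [set y : vec R n | Q (xi y)].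
Proof.
rewrite (_ : [set y | _] =
    \bigcup_(X in [set X | Q X]) \bigcap_(i in [set: 'I_n])
      [set y : vec R n | ((tnth y i : R) != 0) = (i \in X)]).
  apply: fin_bigcup_measurable; first exact: finite_finset.
  move=> X _; apply: fin_bigcap_measurable; first exact: finite_finset.
  move=> i _.
  have m0 : measurable [set y : vec R n | (tnth y i : R) = 0].
    rewrite -[X in measurable X]setTI.
    exact: (@measurable_tnth _ (measurableTypeR R) n i _ [set (0 : R)]).
  case: (i \in X).
    rewrite (_ : [set y | _] = ~` [set y : vec R n | (tnth y i : R) = 0]).
      exact: measurableC.
    by apply/seteqP; split => y /= /eqP.
  rewrite (_ : [set y | _] = [set y : vec R n | (tnth y i : R) = 0])//.
  by apply/seteqP; split => y /=; [move=> /negbFE/eqP|move=> ->; rewrite eqxx].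
apply/seteqP; split => y /=.
  by move=> Qy; exists (xi y) => //= i _ /=; rewrite inE.
move=> [X QX yX]; suff -> : xi y = X by [].
by apply/setP => i; rewrite inE; exact: yX.
Qed.

Lemma majorizes_xi (y z : vec R n) : majorizes y z -> xi z \subset xi y.
Proof.
move=> yz; apply/fintype.subsetP => i; rewrite !inE -!normr_gt0.
by have [_] := yz i; move=> /[swap]; exact: lt_le_trans.
Qed.

End support.

(** * Boosting all nonzero means, one coordinate at a time *)

Section boost.
Context {R : realType}.

Lemma vshift_vcons n (x y : R) (b e : vec R n) :
  vshift (vcons (x, b)) (vcons (y, e)) = vcons (x + y, vshift b e).
Proof.
apply: eq_from_tnth => i; rewrite tnth_mktuple.
by case: (unliftP ord0 i) => [j|] ->; rewrite ?tnthS ?tnth_mktuple// !tnth0.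
Qed.

Lemma majorizes_vcons n (x y : R) (b c : vec R n) :
  0 <= Num.sg x * Num.sg y -> `|y| <= `|x| -> majorizes b c ->
  majorizes (vcons (x, b)) (vcons (y, c)).
Proof.
move=> sxy yx bc i; case: (unliftP ord0 i) => [j|] ->; last by rewrite !tnth0.
by rewrite !tnthS; exact: bc.
Qed.

Lemma majorizes_refl n (y : vec R n) : majorizes y y.
Proof. by move=> i; split => //; rewrite -expr2 sqr_ge0. Qed.

Lemma measurable_fun_comp_vcons n (h : vec R n.+1 -> \bar R)
    (f : measurableTypeR R -> measurableTypeR R) (g : vec R n -> vec R n) :
  measurable_fun setT h -> measurable_fun setT f -> measurable_fun setT g ->
  measurable_fun setT
    (fun p : measurableTypeR R * vec R n => h (vcons (f p.1, g p.2))).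
Proof.
move=> mh mf mg; apply: (measurableT_comp mh).
apply: (measurableT_comp (@measurable_vcons R n)).
apply: measurable_fun_pair; apply: measurableT_comp => //.
Qed.

Lemma measurable_addl (x : R) :
  measurable_fun setT (fun u : measurableTypeR R => x + u : measurableTypeR R).
Proof. exact: measurable_funD. Qed.

Lemma integral_std_gaussianS n (h : vec R n.+1 -> \bar R) (x : R) (b : vec R n) :
  measurable_fun setT h -> (forall y, 0 <= h y)%E ->
  (\int[std_gaussian n.+1]_e h (vshift (vcons (x, b)) e) =
   \int[normal_prob 0 1]_u \int[std_gaussian n]_e
     h (vcons ((x + u)%R, vshift b e)))%E.
Proof.
move=> mh h0; rewrite /= ge0_integral_distribution//; last first.
  by apply: (measurableT_comp mh); exact: measurable_vshift.
transitivity (\int[normal_prob 0 1 \x std_gaussian n]_p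
    h (vcons ((x + p.1)%R, vshift b p.2)))%E.
  by apply: eq_integral => -[u e] _ /=; rewrite vshift_vcons.
apply: (@fubini_tonelli1 _ _ _ _ _ (normal_prob 0 1) (std_gaussian n)
  (fun p : measurableTypeR R * vec R n => h (vcons ((x + p.1)%R, vshift b p.2)))) => //.
by apply: measurable_fun_comp_vcons => //; exact: measurable_addl.
Qed.

Lemma integral_le1 d (X : measurableType d) (P : probability X R) (f : X -> \bar R) :
  measurable_fun setT f -> (forall x, 0 <= f x <= 1)%E ->
  (0 <= \int[P]_x f x <= 1)%E.
Proof.
move=> mf f01; apply/andP; split.
  by apply: integral_ge0 => x _; have /andP[] := f01 x.
apply: (@le_trans _ _ (\int[P]_x cst 1 x)%E).
  by apply: ge0_le_integral => // x _; have /andP[] := f01 x.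
by rewrite integral_cst// mul1e probability_le1.
Qed.

(** Induction on [n], spending [delta / 2] on the first mean and [delta / 2] on the others.
    Functions with values in [[0, 1]] replace indicators because the induction passes to partial
    averages. Zero means stay zero, which preserves the support. *)
Lemma boost_means n (h : vec R n -> \bar R) (b : vec R n) (T delta : R) :
  measurable_fun setT h -> (forall y, 0 <= h y <= 1)%E ->
  (forall y z, majorizes y z -> (h z <= h y)%E) -> 0 < delta ->
  exists b' : vec R n,
    (forall i, if (tnth b i : R) == 0 then (tnth b' i : R) == 0
               else T <= `|tnth b' i : R|) /\
    (\int[std_gaussian n]_e h (vshift b e) <=
     \int[std_gaussian n]_e h (vshift b' e) + delta%:E)%E.
Proof.
elim: n h b delta => [|n IH] h b delta mh h01 hmono d0.
  by exists b; split => [[]//|]; rewrite leeDl// lee_fin ltW.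
have h0 y : (0 <= h y)%E by have /andP[] := h01 y.
have d2 : 0 < delta / 2 by rewrite divr_gt0.
have [x [c ->{b}]] : exists (x : R) (c : vec R n), b = vcons (x, c).
  by case/tupleP: b => x c; exists x, c.
(* Averaging [h] over the other coordinates, with their original means [c], keeps the range and the
   monotonicity that [shift_mean] needs. *)
pose H (u : measurableTypeR R) := (\int[std_gaussian n]_e h (vcons (u, vshift c e)))%E.
have mhv (u : R) (v : vec R n) : measurable_fun setT (fun e => h (vcons (u, vshift v e))).
  apply: (measurableT_comp mh); apply: (measurableT_comp (@measurable_vcons R n)).
  by apply: measurable_fun_pair => //; exact: measurable_vshift.
have mhx (y : R) (v : vec R n) :
    measurable_fun setT (fun u : measurableTypeR R => h (vcons ((y + u)%R, v))).
  apply: (measurableT_comp mh); apply: (measurableT_comp (@measurable_vcons R n)).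
  by apply: measurable_fun_pair => //; exact: measurable_addl.
have [x' [xx' Hx']] : exists x' : R,
    (if x == 0 then x' == 0 else T <= `|x'|) /\
    (\int[normal_prob 0 1]_u H (x + u)%R <=
     \int[normal_prob 0 1]_u H (x' + u)%R + (delta / 2)%:E)%E.
  case: eqP => [->|_].
    by exists 0; rewrite eqxx; split => //; rewrite leeDl// lee_fin ltW.
  apply: shift_mean => //.
  - apply: (measurable_fun_fubini_tonelli_F
      (fun p : measurableTypeR R * vec R n => h (vcons (p.1, vshift c p.2)))) => //.
    by apply: (@measurable_fun_comp_vcons _ _ id (vshift c)).
  - by move=> u; apply: (integral_le1 _ (mhv u c)).
  - move=> u v suv uv; apply: ge0_le_integral => //.
    by move=> e _; apply: hmono; apply: majorizes_vcons => //; exact: majorizes_refl.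
(* The first coordinate is averaged out with its new mean [x'], so the gain from the induction
   hypothesis adds to the one already obtained. *)
pose g (v : vec R n) := (\int[normal_prob 0 1]_u h (vcons ((x' + u)%R, v)))%E.
have [||||c' [cc' gc']] := IH g c (delta / 2).
- apply: (measurable_fun_fubini_tonelli_G
    (fun p : measurableTypeR R * vec R n => h (vcons ((x' + p.1)%R, p.2)))) => //.
  apply: (@measurable_fun_comp_vcons _ _ (fun u => x' + u) id) => //.
  exact: measurable_addl.
- by move=> v; apply: (integral_le1 _ (mhx x' v)).
- move=> y z yz; apply: ge0_le_integral => //.
  move=> u _; apply: hmono; apply: majorizes_vcons => //.
  by rewrite -expr2 sqr_ge0.
- exact: d2.
(* Tonelli links the two orders of averaging, that of [H] and that of [g]. *)
have swap (v : vec R n) : (\int[normal_prob 0 1]_u \int[std_gaussian n]_e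
      h (vcons ((x' + u)%R, vshift v e)) = \int[std_gaussian n]_e g (vshift v e))%E.
  apply: (@fubini_tonelli _ _ _ _ _ (normal_prob 0 1) (std_gaussian n)
  (fun p : measurableTypeR R * vec R n => h (vcons ((x' + p.1)%R, vshift v p.2)))) => //.
  by apply: measurable_fun_comp_vcons => //; exact: measurable_addl.
exists (vcons (x', c')); split.
  move=> i; case: (unliftP ord0 i) => [j|] ->; last by rewrite !tnth0.
  by rewrite !tnthS; exact: cc'.
rewrite !integral_std_gaussianS//; apply: (le_trans Hx'); rewrite swap /H swap.
by rewrite [delta in leRHS]splitr EFinD addeA leeD2r.
Qed.

End boost.

(** * Boosting for probabilities of upward closed events *)

Section gaussian_boost.
Context {R : realType} (n : nat).

Lemma gaussianE (b : vec R n) (A : set (vec R n)) : measurable A ->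
  (gaussian b A = \int[std_gaussian n]_e (\1_A (vshift b e) : R)%:E)%E.
Proof.
move=> mA; rewrite -[in LHS](setIT A) -[LHS]integral_indic//.
rewrite ge0_integral_distribution//.
by apply/measurable_EFinP; exact: measurable_indic.
Qed.

Lemma gaussian_boost (A : set (vec R n)) (b : vec R n) (T delta : R) :
  measurable A -> (forall y z, majorizes y z -> A z -> A y) ->
  0 < T -> 0 < delta ->
  exists b' : vec R n, [/\ xi b' = xi b, (T%:E <= norm_min b')%E &
    (gaussian b A <= gaussian b' A + delta%:E)%E].
Proof.
move=> mA Aup T0 d0.
have [||y z yz|//|b' [bb' hb']] :=
  @boost_means R n (fun y => (\1_A y : R)%:E) b T delta.
- by apply/measurable_EFinP; exact: measurable_indic.
- by move=> y; rewrite !lee_fin indicE; case: (y \in A); rewrite lexx ler01.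
- rewrite lee_fin !indicE; have [zA|//] := boolP (z \in A).
  by rewrite mem_set//; apply: Aup yz _; rewrite -in_setE.
have xibb' : xi b' = xi b.
  apply/setP => i; rewrite !inE; have := bb' i; case: eqP => [_ -> //|_ Tb'].
  by rewrite -normr_gt0 (lt_le_trans T0).
exists b'; split => //.
(* The default value [+oo] of the minimum covers an empty support. *)
- apply: le_bigmin; first by rewrite leey.
  move=> i; rewrite xibb' inE => bi; rewrite lee_fin.
  by have := bb' i; rewrite (negbTE bi).
- by rewrite !gaussianE.
Qed.

End gaussian_boost.

(** * From exact recovery to the absence of false positives *)

Theorem lemma3p1 (R : realType) (zeta : R) (t : nat -> nat -> R)
    (bhat : estimator R) :
  0 < zeta <= 1 ->
  (forall n s : nat, 0 < t n s) ->
  monotone_estimator bhat ->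
  Omega1 zeta t bhat ->
  Omega2 zeta bhat.
Proof.
move=> _ t0 bmono Om1 s beta sbeta szeta.
have FP0 n (b y : vec R n) : (FP b y = 0%N) <-> (xi y \subset xi b).
  by rewrite /FP -finset.setD_eq0 -cards_eq0; split => /eqP.
have mQ n (Q : {set 'I_n} -> Prop) : measurable [set y : vec R n | Q (xi (bhat n y))].
  rewrite -[X in measurable X]setTI.
  exact: (measurable_funPT (bhat n) measurableT _ (measurable_xi Q)).
pose A n := [set y : vec R n | FP (beta n) (bhat n y) = 0%N].
have mA n : measurable (A n) by exact: (mQ n (fun X => #|X :\: xi (beta n)| = 0%N)).
(* The threshold is the minimal signal [t n (s n)], and the error [1 / (n + 1)] vanishes in the
   limit. *)
have /all_sig[beta' beta'P] n : {b' : vec R n | [/\ xi b' = xi (beta n),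
    ((t n (s n))%:E <= norm_min b')%E &
    (gaussian (beta n) (~` A n) <= gaussian b' (~` A n) + (n.+1%:R^-1)%:E)%E]}.
  apply/cid; apply: gaussian_boost => //; first exact: (measurableC (mA n)).
  move=> y z yz; apply: contra_not => /FP0 yb; apply/FP0.
  by apply: (fintype.subset_trans _ yb); apply: majorizes_xi; exact: bmono.
have cvg1 := Om1 s beta' _ szeta _.
(* The probability of [A n] lies between 1 and the recovery probability under [beta'] minus
   [1 / (n + 1)]. *)
apply: (@squeeze_cvge _ _ _ _ (fun n => gaussian (beta' n)
    [set y | xi (bhat n y) = xi (beta' n)] - (n.+1%:R^-1)%:E)%E _ (cst 1%E)).
- near=> n; apply/andP; split; last exact: (probability_le1 _ (mA n)).
  have [xib' _] := beta'P n; rewrite !(probability_setC _ (mA n)) => le_compl.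
  (* Since [beta n] and [beta' n] have the same support, exact recovery of [beta' n] implies
     [A n]. *)
  apply: (@le_trans _ _ (gaussian (beta' n) (A n) - (n.+1%:R^-1)%:E)%E).
    apply: leeB => //; apply: le_measure; rewrite ?inE; [|exact: mA|].
      exact: (mQ n (fun X => X = _)).
    by move=> y /= yb'; apply/FP0; rewrite yb' xib'.
  move: le_compl.
  rewrite -(fineK (fin_num_measure (gaussian (beta n)) _ (mA n))).
  rewrite -(fineK (fin_num_measure (gaussian (beta' n)) _ (mA n))).
  rewrite -!EFinB -EFinD !lee_fin.
  by move: (fine _) (fine _) (_^-1) => p q d; lra.
- rewrite -[X in _ --> X]sube0; apply: cvgeB => //.
    apply: cvg1.
      by move=> n; rewrite /sparse /=; have [-> _ _] := beta'P n; exact: sbeta.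
    by move=> n; have [] := beta'P n.
  apply: cvg_EFin; first by near=> n.
  exact: cvg_harmonic.
- exact: cvg_cst.
Unshelve. all: by end_near.
Qed.
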